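(* Let $p$ be a prime, let $\alpha,\beta,X,Y$ be indeterminates over $\mathbb F_p$, and let $P^{(\alpha)}(X)$ be a nonzero polynomial in $\mathbb F_p(\alpha)[X]$ of degree less than $p$. Suppose there exist rational expressions $s_i(\alpha,\beta)\in\mathbb F_p(\alpha,\beta)$, $1\le i\le p-1$, such that \[ P^{(\alpha)}(X)\cdot P^{(\beta)}(Y)\equiv P^{(\alpha+\beta)}(X+Y)\cdot\Bigl(1+\sum_{i=1}^{p-1}s_i(\alpha,\beta)X^iY^{p-i}\Bigr) \] in $\mathbb F_p(\alpha,\beta)[X,Y]$ modulo the ideal generated by $X^p-(\alpha^p-\alpha)$ and $Y^p-(\beta^p-\beta)$. Assume that none of the denominators of the $s_i(\alpha,\beta)$ has $\beta$ as a factor (so that $s_i(\alpha,0)$ is defined), and that $0$ is not a pole of $s_{p-1}(\alpha,0)$, nor of any coefficient of $P^{(\alpha)}(X)$ (so that $s_{p-1}(0,0)$ and $P^{(0)}(X)$ are defined). Then $P^{(\alpha)}(X)=\mathcal{E}^{(c\alpha)}(cX)$ for some $c\in\mathbb F_p$.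
   Context: Here $P^{(\beta)}(Y)$ and $P^{(\alpha+\beta)}(X+Y)$ denote the polynomial obtained from $P^{(\alpha)}(X)$ by substituting $\beta$ (resp. $\alpha+\beta$) for $\alpha$ in the coefficients and $Y$ (resp. $X+Y$) for $X$. For a parameter $\gamma$, $\mathcal{E}^{(\gamma)}(X)=\sum_{k=0}^{p-1}X^k/\bigl((1+\gamma)(2+\gamma)\cdots(k+\gamma)\bigr)$, so $\mathcal{E}^{(c\alpha)}(cX)=\sum_{k=0}^{p-1}c^kX^k/\bigl((1+c\alpha)\cdots(k+c\alpha)\bigr)$. *)

(* Defs.v *)
From HB Require Import structures.
From mathcomp Require Import all_boot all_order all_algebra.

Set Implicit Arguments.
Unset Strict Implicit.
Unset Printing Implicit Defensive.

Import GRing.Theory.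
Local Open Scope ring_scope.
Local Open Scope quotient_scope.

Notation tofrac := (@FracField.tofrac _).

(* F_p(alpha) *)
Notation ratfun1 p := {fraction {poly 'F_p}}.

(* F_p(alpha, beta), as the fraction field of F_p[alpha][beta]: the inner
   variable is alpha, the outer one is beta. *)
Notation ratfun2 p := {fraction {poly {poly 'F_p}}}.

Definition alpha1 (p : nat) : ratfun1 p := tofrac 'X.
Definition alpha2 (p : nat) : ratfun2 p := tofrac ('X%:P).
Definition beta2 (p : nat) : ratfun2 p := tofrac 'X.

Definition const1 (p : nat) (c : 'F_p) : ratfun1 p := tofrac (c%:P).
Definition const2 (p : nat) (c : 'F_p) : ratfun2 p := tofrac (c%:P%:P).

Definition peval (p : nat) (t : ratfun2 p) (q : {poly 'F_p}) : ratfun2 p :=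
  (map_poly (@const2 p) q).[t].

(* Substitution of t for alpha in an element of F_p(alpha), computed on the
   canonical representative n / d.  It does not depend on the representative
   when t is transcendental over F_p (lemma fsubst_frac), as alpha, beta and
   alpha + beta are (lemmas peval_*_neq0); it is not meant for other values of t. *)
Definition fsubst (p : nat) (t : ratfun2 p) (f : ratfun1 p) : ratfun2 p :=
  peval t \n_(repr f) / peval t \d_(repr f).

Fact const2_is_zmod_morphism (p : nat) : zmod_morphism (@const2 p).
Proof. by move=> x y; rewrite /const2 !rmorphB. Qed.
Fact const2_is_monoid_morphism (p : nat) : monoid_morphism (@const2 p).
Proof. by split=> [|x y]; rewrite /const2 ?rmorph1 // !rmorphM. Qed.
HB.instance Definition _ (p : nat) :=
  GRing.isZmodMorphism.Build 'F_p (ratfun2 p) (@const2 p)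
    (@const2_is_zmod_morphism p).
HB.instance Definition _ (p : nat) :=
  GRing.isMonoidMorphism.Build 'F_p (ratfun2 p) (@const2 p)
    (@const2_is_monoid_morphism p).

Lemma fsubst_frac (p : nat) (t : ratfun2 p) (n d : {poly 'F_p}) :
  (forall q, q != 0 -> peval t q != 0) -> d != 0 ->
  fsubst t (tofrac n / tofrac d) = peval t n / peval t d.
Proof.
move=> t_tr d0; rewrite /fsubst; set f := tofrac n / tofrac d.
have r0 : \d_(repr f) != 0 by apply: denom_ratioP.
have fE : f = tofrac \n_(repr f) / tofrac \d_(repr f).
  rewrite -[LHS]reprK -{1}[repr f]Ratio_numden.
  move: r0; move: \n_(repr f) \d_(repr f) => a b b0.
  apply: (canRL (mulfK _)); first by rewrite tofrac_eq0.
  rewrite /FracField.tofrac; unlock.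
  rewrite -[LHS]/(FracField.mul _ _) -FracField.pi_mul.
  apply/eqmodP; rewrite /= FracField.equivfE /FracField.mulf.
  by rewrite !numden_Ratio ?mulf_neq0 ?oner_eq0 // !mulr1 mulrC.
have : tofrac n * tofrac \d_(repr f) = tofrac \n_(repr f) * tofrac d.
  apply/eqP; rewrite -eqr_div ?tofrac_eq0 //; exact/eqP.
rewrite -!rmorphM => /eqP; rewrite tofrac_eq => /eqP/(congr1 (peval t)).
rewrite /peval !rmorphM !hornerM => E.
by apply/eqP; rewrite eqr_div ?E //; apply: t_tr.
Qed.

Lemma peval_tofrac (p : nat) (r : {poly {poly 'F_p}}) (q : {poly 'F_p}) :
  peval (tofrac r) q = tofrac ((map_poly polyC (map_poly polyC q)).[r]).
Proof. by rewrite /peval -[RHS]horner_map -!map_poly_comp. Qed.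

Lemma peval_alpha_neq0 (p : nat) (q : {poly 'F_p}) :
  q != 0 -> peval (alpha2 p) q != 0.
Proof.
move=> q0; rewrite /alpha2 peval_tofrac tofrac_eq0 horner_map /= polyC_eq0.
by rewrite -/(comp_poly 'X q) comp_polyXr.
Qed.

Lemma peval_beta_neq0 (p : nat) (q : {poly 'F_p}) :
  q != 0 -> peval (beta2 p) q != 0.
Proof.
move=> q0; rewrite /beta2 peval_tofrac tofrac_eq0 -/(comp_poly _ _).
by rewrite comp_polyXr map_polyC_eq0.
Qed.

Lemma peval_alphaDbeta_neq0 (p : nat) (q : {poly 'F_p}) :
  q != 0 -> peval (alpha2 p + beta2 p) q != 0.
Proof.
move=> q0; rewrite /alpha2 /beta2 -rmorphD peval_tofrac tofrac_eq0.
rewrite -/(comp_poly _ _) addrC comp_poly2_eq0 ?map_polyC_eq0 //.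
exact: size_XaddC.
Qed.

(* n / d is a reduced form of f.  Both F_p[alpha] and F_p[alpha][beta] are
   unique factorization domains, so that such a form exists and d, the
   denominator of f, is unique up to a unit. *)
Definition reduced_form (R : idomainType) (f : {fraction R}) (n d : R) : Prop :=
  [/\ d != 0, f = tofrac n / tofrac d &
      forall g a b : R, n = g * a -> d = g * b -> g \is a GRing.unit].

Definition not_pole (p : nat) (f : ratfun1 p) (a : 'F_p) : Prop :=
  exists n d : {poly 'F_p}, reduced_form f n d /\ ~~ root d a.

Definition beta_free_denom (p : nat) (s : ratfun2 p) : Prop :=
  exists n d : {poly {poly 'F_p}}, reduced_form s n d /\ ~~ ('X %| d).

(* s(alpha, 0) is defined and equal to f *)
Definition value_beta0 (p : nat) (s : ratfun2 p) (f : ratfun1 p) : Prop :=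
  exists n d : {poly {poly 'F_p}},
    [/\ reduced_form s n d, ~~ ('X %| d) & f = tofrac n.[0] / tofrac d.[0]].

(* F_p(alpha, beta)[X, Y]: the inner variable is X, the outer one is Y. *)
Notation polyFXY p := {poly {poly (ratfun2 p)}}.

Definition cXY (p : nat) (a : ratfun2 p) : polyFXY p := a%:P%:P.
Definition varX (p : nat) : polyFXY p := 'X%:P.
Definition varY (p : nat) : polyFXY p := 'X.

(* P^(t)(Z) *)
Definition subst_poly (p : nat) (P : {poly ratfun1 p}) (t : ratfun2 p)
    (Z : polyFXY p) : polyFXY p :=
  \sum_(k < size P) cXY (fsubst t P`_k) * Z ^+ k.

Definition congr_ideal2 (R : comNzRingType) (g h u v : R) : Prop :=
  exists a b : R, u - v = a * g + b * h.

Definition calE (p : nat) (F : fieldType) (gamma : F) : {poly F} :=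
  \poly_(k < p) (\prod_(1 <= j < k.+1) (j%:R + gamma))^-1.

(* Main.v *)
Require Import Defs.
From HB Require Import structures.
From mathcomp Require Import all_boot all_order all_algebra.
From mathcomp Require Import finfield zify ring.

(* Write P^(alpha)(X) = sum_k a_k X^k and A = alpha^p - alpha.  At beta = 0 the
   congruence lives modulo X^p - A and Y^p.  Its coefficient of Y^0 gives
   a_0(0) = 1; its coefficient of Y^1 reads
     c P = P' + f X^(p-1) P   modulo X^p - A,
   with c = a_1(0) and f = s_(p-1)(alpha, 0).  Comparing the coefficients of X^u,
   (k + t) a_k = c a_(k-1) for 0 < k < p and c a_(p-1) = f a_0, where t = f A
   vanishes at alpha = 0.  Eliminating the a_k yields t^p - t = c A, whence
   t = c alpha and P is a_0 times the wanted polynomial.  Finally, the constant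
   coefficient of the congruence for general beta is
   a_0(alpha) a_0(beta) = a_0(alpha + beta), which forces a_0 = 1. *)

Set Implicit Arguments.
Unset Strict Implicit.
Unset Printing Implicit Defensive.

Import GRing.Theory.
Local Open Scope ring_scope.
Local Open Scope quotient_scope.

(** * Fractions, and relations compatible with sums and products *)

Lemma frac_numden (R : idomainType) (f : {fraction R}) :
  exists2 d : R, d != 0 & exists n : R, f = tofrac n / tofrac d.
Proof.
exists \d_(repr f); first exact: denom_ratioP.
exists \n_(repr f); rewrite -[LHS]reprK -{1}[repr f]Ratio_numden.
have : \d_(repr f) != 0 by apply: denom_ratioP.
move: \n_(repr f) \d_(repr f) => a b b0.
apply: (canRL (mulfK _)); first by rewrite tofrac_eq0.
rewrite /FracField.tofrac; unlock.
rewrite -[LHS]/(FracField.mul _ _) -FracField.pi_mul.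
apply/eqmodP; rewrite /= FracField.equivfE /FracField.mulf.
by rewrite !numden_Ratio ?mulf_neq0 ?oner_eq0 // !mulr1 mulrC.
Qed.

(** Specialization is defined only on fractions whose denominator does not vanish, hence a relation
    rather than a morphism; its graph is a subsemiring of R x S. *)
Definition semiring_rel (R S : comNzRingType) (r : R -> S -> Prop) : Prop :=
  [/\ r 0 0, r 1 1,
      forall x a y b, r x a -> r y b -> r (x + y) (a + b) &
      forall x a y b, r x a -> r y b -> r (x * y) (a * b)].

Section SemiringRel.
Variables (R S : comNzRingType) (r : R -> S -> Prop).
Hypothesis rP : semiring_rel r.

Lemma rel_sum (I : Type) (s : seq I) (Q : pred I) (f : I -> R) (g : I -> S) :
  (forall i, Q i -> r (f i) (g i)) ->
  r (\sum_(i <- s | Q i) f i) (\sum_(i <- s | Q i) g i).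
Proof. by case: rP => r0 _ rD _ rfg; apply: (big_ind2 r). Qed.

Lemma rel_exp (x : R) (a : S) n : r x a -> r (x ^+ n) (a ^+ n).
Proof.
case: rP => _ r1 _ rM rxa; elim: n => [|n IHn]; first by rewrite !expr0.
by rewrite !exprS; apply: rM.
Qed.

Definition poly_rel (q : {poly R}) (q' : {poly S}) : Prop :=
  forall i, r q`_i q'`_i.

Lemma poly_rel_semiring : semiring_rel poly_rel.
Proof.
case: (rP) => r0 r1 rD rM; split=> [i|i|x a y b xa yb i|x a y b xa yb i].
- by rewrite !coef0.
- by rewrite !coef1; case: eqP.
- by rewrite !coefD; apply: rD.
- by rewrite !coefM; apply: rel_sum => j _; apply: rM.
Qed.

Lemma poly_relC x a : r x a -> poly_rel x%:P a%:P.
Proof. by case: rP => r0 _ _ _ xa i; rewrite !coefC; case: eqP. Qed.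

Lemma poly_relX : poly_rel 'X 'X.
Proof. by case: rP => r0 r1 _ _ i; rewrite !coefX; case: eqP. Qed.

End SemiringRel.

(** * Linear forms on polynomials and reduction modulo X^n - A *)

Section WeightedSum.
Variable (R : comNzRingType).
Implicit Types (w : nat -> R) (q : {poly R}).

(** The linear form with X^k mapped to [w k]. Coefficient extraction and reduction modulo X^n - A
    are both of this kind, which avoids polynomial division. *)
Definition wsum w q : R := \sum_(k < size q) w k * q`_k.

Lemma wsum_wide w q n : (size q <= n)%N -> wsum w q = \sum_(k < n) w k * q`_k.
Proof.
move=> qn; rewrite /wsum (big_ord_widen n (fun k => w k * q`_k) qn).
rewrite big_mkcond; apply: eq_bigr => k _; case: ltnP => // qk.
by rewrite nth_default // mulr0.
Qed.

Lemma wsum_is_linear w : scalar (wsum w).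
Proof.
move=> a u v; set n := maxn (size u) (size v).
rewrite !(@wsum_wide _ _ n) ?leq_maxl ?leq_maxr //; last first.
  by rewrite (leq_trans (size_polyD _ _)) // geq_max leq_maxr
             (leq_trans (size_scale_leq _ _)) // leq_maxl.
rewrite mulr_sumr -big_split; apply: eq_bigr => k _ /=.
by rewrite coefD coefZ mulrDr mulrCA.
Qed.
HB.instance Definition _ w :=
  GRing.isLinear.Build R {poly R} R *%R (wsum w) (wsum_is_linear w).

Lemma wsumC w c q : wsum w (c%:P * q) = c * wsum w q.
Proof. by rewrite mul_polyC linearZ. Qed.

Lemma wsumXn w n q : wsum w ('X^n * q) = wsum (fun k => w (n + k)%N) q.
Proof.
rewrite (@wsum_wide _ _ (n + size q)); last first.
  by rewrite (leq_trans (size_polyMleq _ _)) // size_polyXn.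
rewrite big_split_ord /= big1 ?add0r => [|k _]; last first.
  by rewrite coefXnM ltn_ord mulr0.
by apply: eq_bigr => k _; rewrite coefXnM ltnNge leq_addr /= addKn.
Qed.

Lemma wsum_eq w w' q : (forall k, (k < size q)%N -> w k = w' k) ->
  wsum w q = wsum w' q.
Proof. by move=> ww'; apply: eq_bigr => k _; rewrite ww'. Qed.

Lemma wsum_coef v q : wsum (fun k => (k == v)%:R) q = q`_v.
Proof.
rewrite (@wsum_wide _ _ (maxn (size q) v.+1)) ?leq_maxl //.
have vn : (v < maxn (size q) v.+1)%N by rewrite leq_maxr.
rewrite (bigD1 (Ordinal vn)) //= eqxx mul1r big1 ?addr0 // => k.
by rewrite -val_eqE /= => /negPf->; rewrite mul0r.
Qed.

Lemma wsum_monomial w n : wsum w 'X^n = w n.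
Proof.
rewrite -['X^n]mulr1 wsumXn /wsum size_poly1 big_ord1 coef1 mulr1.
by rewrite addn0.
Qed.

(** Multiplication by X^n shifts the weights by n, which by hypothesis multiplies them by A. *)
Lemma wsum_ideal w (n : nat) (A : R) q :
  (forall k, w (n + k)%N = A * w k) -> wsum w (q * ('X^n - A%:P)) = 0.
Proof.
move=> wA; rewrite mulrBr ![q * _]mulrC linearB /= wsumXn wsumC.
apply/eqP; rewrite subr_eq0 /wsum mulr_sumr; apply/eqP.
by apply: eq_bigr => k _; rewrite wA mulrA.
Qed.

End WeightedSum.

Lemma wsum_rel (R S : comNzRingType) (r : R -> S -> Prop) w w' q q' :
  semiring_rel r -> (forall k, r (w k) (w' k)) -> poly_rel r q q' ->
  r (wsum w q) (wsum w' q').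
Proof.
move=> rP rw rq; set n := maxn (size q) (size q').
rewrite !(@wsum_wide _ _ _ n) ?leq_maxl ?leq_maxr //.
by apply: rel_sum => // k _; case: rP => _ _ _; apply.
Qed.

(* The weights of the coefficient of X^u in the reduction modulo X^n - A. *)
Definition reduction_weight (R : comNzRingType) (n : nat) (A : R) (u k : nat) : R :=
  if (k %% n == u)%N then A ^+ (k %/ n)%N else 0.

Lemma reduction_weightD (R : comNzRingType) n (A : R) u k : (0 < n)%N ->
  reduction_weight n A u (n + k) = A * reduction_weight n A u k.
Proof.
move=> n0; rewrite /reduction_weight modnDl divnDl // divnn n0 add1n.
by case: eqP; rewrite ?mulr0 // exprS.
Qed.

Lemma reduction_weight_small (R : comNzRingType) n (A : R) u k : (k < n)%N ->
  reduction_weight n A u k = (k == u)%:R.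
Proof.
by move=> kn; rewrite /reduction_weight modn_small // divn_small //; case: eqP.
Qed.

(** For k >= n the weight is 0 or a positive power of 0. The case A = 0 serves for beta^p - beta,
    which vanishes at beta = 0. *)
Lemma reduction_weight0 (R : comNzRingType) n u k : (0 < n)%N -> (u < n)%N ->
  reduction_weight n (0 : R) u k = (k == u)%:R.
Proof.
move=> n0 un; have [kn|nk] := ltnP k n; first exact: reduction_weight_small.
rewrite /reduction_weight expr0n -leqn0 -ltnS ltnNge divn_gt0 // nk /= if_same.
by case: eqP => // ku; rewrite ku leqNgt un in nk.
Qed.

(* The coefficient of X^u Y^v in the normal form modulo X^n - A and Y^n - B. *)
Definition normal_coef (R : comNzRingType) (n : nat) (A B : R) (u v : nat)
    (q : {poly {poly R}}) : R :=
  wsum (reduction_weight n A u) (wsum (reduction_weight n B%:P v) q).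

(** The inner form kills the multiples of Y^n - B, the outer one those of X^n - A. *)
Lemma normal_coef_congr (R : comNzRingType) n (A B : R) u v q q' : (0 < n)%N ->
  congr_ideal2 ('X%:P ^+ n - A%:P%:P) ('X^n - B%:P%:P) q q' ->
  normal_coef n A B u v q = normal_coef n A B u v q'.
Proof.
move=> n0 [a [b qE]]; apply/eqP; rewrite -subr_eq0 /normal_coef -!linearB /= qE.
rewrite !linearD /= [wsum _ (b * _)]wsum_ideal; last first.
  by move=> k; rewrite reduction_weightD.
(* X^n - A does not involve Y, so it comes out of the inner form as a scalar. *)
rewrite linear0 addr0 -polyC_exp -polyCB mulrC wsumC mulrC wsum_ideal //.
by move=> k; rewrite reduction_weightD.
Qed.

(** * Specialization of fractions *)

Section Specialization.
Variables (D : idomainType) (F : fieldType) (ev : {rmorphism D -> F}).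

(* The graph of the extension of [ev] to the localization of D at its kernel. *)
Definition specializes (f : {fraction D}) (a : F) : Prop :=
  exists n d : D, [/\ ev d != 0, f = tofrac n / tofrac d & a = ev n / ev d].

Lemma specializes_tofrac n : specializes (tofrac n) (ev n).
Proof. by exists n, 1; rewrite !rmorph1 oner_eq0 !divr1. Qed.

Let ev_neq0 d : ev d != 0 -> tofrac d != 0 :> {fraction D}.
Proof. by rewrite tofrac_eq0; apply: contraNneq => ->; rewrite rmorph0. Qed.

Lemma specializes_fun f a b : specializes f a -> specializes f b -> a = b.
Proof.
move=> [n [d [d0 -> ->]]] [m [e [e0 E ->]]].
move/eqP: E; rewrite eqr_div ?ev_neq0 // -!rmorphM tofrac_eq => /eqP E.
by apply/eqP; rewrite eqr_div // -!rmorphM E.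
Qed.

Lemma specializes_semiring : semiring_rel specializes.
Proof.
split.
- by rewrite -tofrac0 -(rmorph0 ev); apply: specializes_tofrac.
- by rewrite -tofrac1 -(rmorph1 ev); apply: specializes_tofrac.
- move=> _ _ _ _ [n [d [d0 -> ->]]] [m [e [e0 -> ->]]].
  exists (n * e + m * d), (d * e); rewrite !rmorphD !rmorphM mulf_neq0 //.
  by rewrite !addf_div ?ev_neq0.
- move=> _ _ _ _ [n [d [d0 -> ->]]] [m [e [e0 -> ->]]].
  by exists (n * m), (d * e); rewrite !rmorphM mulf_neq0 // !mulf_div.
Qed.

End Specialization.

(** Finite choice by induction; it turns the mere existence of specialized values into sequences. *)
Lemma nat_bounded_choice (T : Type) (x0 : T) (Q : nat -> T -> Prop) n :
  (forall i, (i < n)%N -> exists x, Q i x) ->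
  exists f, forall i, (i < n)%N -> Q i (f i).
Proof.
elim: n => [|n IHn] Qn; first by exists (fun=> x0).
have [i /leqW/Qn//|f fP] := IHn; have [//|x Qx] := Qn n.
exists (fun i => if i == n then x else f i) => i.
by rewrite ltnS leq_eqVlt; case: eqP => [->|_ /fP].
Qed.

(** * Solving the recurrence; the polynomial z^p - z over F_p *)

Lemma coef_comp_scaleX (R : comNzRingType) (q : {poly R}) (c : R) k :
  (q \Po (c *: 'X))`_k = q`_k * c ^+ k.
Proof.
rewrite coef_comp_poly; under eq_bigr => i _.
  rewrite exprZn coefZ coefXn mulrCA mulrA mulr_natr; over.
have [qk|kq] := leqP (size q) k.
  rewrite nth_default // mul0r big1 // => i _; case: eqP => // ki.
  by move: (ltn_ord i); rewrite -ki ltnNge qk.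
rewrite (bigD1 (Ordinal kq)) //= eqxx mulr1n mulrC big1 ?addr0 // => i.
by rewrite -val_eqE /= eq_sym => /negPf->.
Qed.

(** Since [k%:R + t] is invertible for 0 < k < p, the recurrence determines all coefficients from
    the constant one, and the right-hand side satisfies it too. *)
Lemma calE_of_recurrence (F : fieldType) (p : nat) (P : {poly F}) (c t : F) :
  (size P <= p)%N ->
  (forall k, (0 < k < p)%N -> k%:R + t != 0) ->
  (forall k, (k.+1 < p)%N -> c * P`_k = (k.+1%:R + t) * P`_k.+1) ->
  P = P`_0 *: (calE p t \Po (c *: 'X)).
Proof.
move=> Pp t0 PS; apply/polyP => k; rewrite coefZ coef_comp_scaleX coef_poly.
have [pk|] := leqP p k; first by rewrite nth_default ?mul0r ?mulr0 ?(leq_trans Pp).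
have prod_neq0 m : (m < p)%N -> \prod_(1 <= j < m.+1) (j%:R + t) != 0.
  move=> mp; rewrite big_nat; elim/big_ind: _ => [|x y|j /andP[j0 jm]].
  - exact: oner_neq0.
  - exact: mulf_neq0.
  - by apply: t0; rewrite j0 (leq_ltn_trans _ mp).
elim: k => [_|k IHk kp]; first by rewrite big_geq // invr1 mul1r expr0 mulr1.
have kn0 := t0 k.+1 kp; apply: (mulfI kn0); rewrite -PS // IHk; last exact: ltnW.
rewrite [\prod_(1 <= j < k.+2) _]big_nat_recr //= invfM exprS.
have := prod_neq0 k (ltnW kp); move: (\prod_(_ <= j < _) _) => x x0; field.
by rewrite -mulrS kn0.
Qed.

Lemma prod_shift_Fp (p : nat) (F : fieldType) (i : {rmorphism 'F_p -> F}) (x : F) :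
  prime p -> \prod_(0 <= j < p) (j%:R + x) = x ^+ p - x.
Proof.
move=> p_pr; have := congr1 (fun q => (map_poly i q).[x]) (finField_genPoly 'F_p).
rewrite card_Fp // rmorphB rmorphXn rmorph_prod /= map_polyX !hornerE => ->.
(* Negation permutes F_p and turns the factors x - j into x + j. *)
rewrite horner_prod (reindex_inj (inv_inj (@opprK 'F_p))) /=.
rewrite -{1}(Fp_cast p_pr) big_mkord; apply: eq_bigr => j _.
rewrite rmorphB /= map_polyX map_polyC /= hornerXsubC rmorphN opprK addrC.
by rewrite -[in RHS](natr_Zp j) rmorph_nat.
Qed.

(** The product of the j + x equals x^p - x = 0, so one factor vanishes. *)
Lemma Frobenius_fixed (p : nat) (F : fieldType) (i : {rmorphism 'F_p -> F}) (x : F) :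
  prime p -> x ^+ p = x -> exists c, x = i c.
Proof.
move=> p_pr xp; have /eqP := prod_shift_Fp i x p_pr.
rewrite xp subrr prodf_seq_eq0 => /hasP[j _ /= /eqP jx].
exists (- j%:R); rewrite rmorphN rmorph_nat; apply/eqP.
by rewrite -addr_eq0 addrC jx.
Qed.

(** * Normal forms of monomials and of products *)

HB.instance Definition _ (R : comNzRingType) n (A B : R) u v :=
  GRing.isZmodMorphism.Build {poly {poly R}} R (normal_coef n A B u v)
    (fun q q' => etrans (congr1 _ (linearB _ q q')) (linearB _ _ _)).

Lemma normal_coef_monomial (R : comNzRingType) n (A B a : R) u v i j :
  normal_coef n A B u v (a%:P%:P * 'X%:P ^+ i * 'X ^+ j) =
  a * reduction_weight n A u i * reduction_weight n B v j.
Proof.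
rewrite /normal_coef -polyC_exp -polyCM wsumC wsum_monomial.
have -> : reduction_weight n B%:P v j = (reduction_weight n B v j)%:P.
  by rewrite /reduction_weight; case: ifP; rewrite ?rmorphXn.
by rewrite mulrC wsumC wsumC wsum_monomial mulrC.
Qed.

(** The monomials of (X + Y)^k have total degree k < n, so they are already reduced. *)
Lemma normal_coef00_exprD (R : comNzRingType) n (A B a : R) k :
  (k < n)%N -> normal_coef n A B 0 0 (a%:P%:P * ('X%:P + 'X) ^+ k) = a *+ (k == 0%N).
Proof.
move=> kn; rewrite exprDn mulr_sumr raddf_sum /=.
under eq_bigr => j _.
  rewrite mulrnAr raddfMn /= mulrA normal_coef_monomial.
  rewrite !reduction_weight_small ?(leq_ltn_trans _ kn) ?leq_subr -1?ltnS //; over.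
case: k kn => [|k] kn; first by rewrite big_ord1 !mulr1.
rewrite big1 // => j _; case: eqP; rewrite ?mulr0 ?mul0r ?mul0rn //.
move/eqP; rewrite subn_eq0 => kj; case: eqP => [j0|_]; last by rewrite mulr0 mul0rn.
by rewrite j0 in kj.
Qed.

(** X^(k-j+i) Y^(j+n-i) reduces to a constant only if n divides both exponents. These are positive,
    so their sum would be at least 2n, but it is k + n < 2n. *)
Lemma normal_coef00_exprD_mixed (R : comNzRingType) n (A B a : R) k i :
  (k < n)%N -> (0 < i < n)%N ->
  normal_coef n A B 0 0
    (a%:P%:P * ('X%:P + 'X) ^+ k * ('X%:P ^+ i * 'X ^+ (n - i))) = 0.
Proof.
move=> kn /andP[i0 iltn].
rewrite exprDn mulr_sumr mulr_suml raddf_sum big1 //= => j _.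
rewrite mulrnAr mulrnAl raddfMn /=.
have -> : a%:P%:P * ('X%:P ^+ (k - j) * 'X^j) * ('X%:P ^+ i * 'X^(n - i))
  = a%:P%:P * 'X%:P ^+ (k - j + i) * 'X ^+ (j + (n - i)) :> {poly {poly R}}.
  by rewrite !exprD; ring.
rewrite normal_coef_monomial /reduction_weight.
have jk : (j <= k)%N by rewrite -ltnS.
case: eqP => [E1|_]; last by rewrite mulr0 mul0r mul0rn.
case: eqP => [E2|_]; last by rewrite mulr0 mul0rn.
have /dvdnP[x Ex] : (n %| k - j + i)%N by rewrite /dvdn E1.
have /dvdnP[y Ey] : (n %| j + (n - i))%N by rewrite /dvdn E2.
have x1 : x = 1%N by nia.
have y1 : y = 1%N by nia.
by exfalso; lia.
Qed.

(** When B specializes to 0, reduction modulo Y^n - B becomes truncation, and for v < n the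
    coefficient of Y^v is simply read off. *)
Lemma normal_coef_rel (R S : comNzRingType) (r : R -> S -> Prop) n A B A' u v q q' :
  semiring_rel r -> r A A' -> r B 0 -> (0 < n)%N -> (v < n)%N ->
  poly_rel (poly_rel r) q q' ->
  r (normal_coef n A B u v q) (wsum (reduction_weight n A' u) q'`_v).
Proof.
move=> rP rA rB n0 vn rq; have rP' := poly_rel_semiring rP.
(* Stated for all rings: it serves both for the coefficients and for polynomials in X. *)
have rw (T U : comNzRingType) (t : T -> U -> Prop) C C' x k :
    semiring_rel t -> t C C' -> t (reduction_weight n C x k) (reduction_weight n C' x k).
  move=> tP tC; rewrite /reduction_weight; case: ifP => _; last by case: tP.
  exact: rel_exp.
apply: wsum_rel => // [k|]; first exact: rw.
rewrite -wsum_coef; apply: wsum_rel => // k.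
rewrite -(@reduction_weight0 _ n) //; apply: (rw _ _ (poly_rel r)) => //.
by rewrite -polyC0; apply: poly_relC.
Qed.

Lemma wsum_reduction_coef (R : comNzRingType) n (A : R) u (q : {poly R}) :
  (size q <= n)%N -> wsum (reduction_weight n A u) q = q`_u.
Proof.
move=> qn; rewrite -wsum_coef; apply: wsum_eq => k kq.
by rewrite reduction_weight_small // (leq_trans kq).
Qed.

(** Multiplication by X^m sends the constant term to degree m, and each X^(k+1) to A X^k. *)
Lemma wsum_reduction_coef_Xn (R : comNzRingType) m (A : R) u (q : {poly R}) :
  (size q <= m.+1)%N -> (u < m.+1)%N ->
  wsum (reduction_weight m.+1 A u) ('X^m * q) = q`_0 *+ (u == m) + A * q`_u.+1.
Proof.
move=> qm um; rewrite wsumXn (wsum_wide _ qm) big_ord_recl /= addn0.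
rewrite reduction_weight_small // eq_sym mulr_natl; congr (_ + _).
under eq_bigr => k _ do rewrite /bump /= add1n addnS -addSn reduction_weightD //
  reduction_weight_small ?(leq_trans (ltn_ord k)) // -mulrA mulr_natl.
rewrite -mulr_sumr; congr (_ * _).
have [mu|um'] := leqP m u.
  (* Here u = m, and the coefficient of index u + 1 is the default 0. *)
  rewrite nth_default ?(leq_trans qm) // big1 // => k _; case: eqP => // ku.
  by move: (ltn_ord k); rewrite ku ltnNge mu.
rewrite (bigD1 (Ordinal um')) //= eqxx big1 ?addr0 // => k.
by rewrite -val_eqE /= => /negPf->.
Qed.

(** * Specialization at alpha = 0 and at beta = 0 *)

HB.instance Definition _ (p : nat) :=
  GRing.RMorphism.copy (@const1 p) (@FracField.tofrac {poly 'F_p} \o polyC).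

Definition at_alpha0 (p : nat) : {poly 'F_p} -> 'F_p := horner_eval 0.
HB.instance Definition _ (p : nat) :=
  GRing.RMorphism.copy (@at_alpha0 p) (horner_eval (0 : 'F_p)).

Definition at_beta0 (p : nat) (q : {poly {poly 'F_p}}) : ratfun1 p :=
  FracField.tofrac q.[0].
HB.instance Definition _ (p : nat) :=
  GRing.RMorphism.copy (@at_beta0 p)
    (@FracField.tofrac {poly 'F_p} \o horner_eval (0 : {poly 'F_p})).

Definition spec_alpha0 (p : nat) : ratfun1 p -> 'F_p -> Prop :=
  @specializes {poly 'F_p} 'F_p (@at_alpha0 p).

Definition spec_beta0 (p : nat) : ratfun2 p -> ratfun1 p -> Prop :=
  @specializes {poly {poly 'F_p}} (ratfun1 p) (@at_beta0 p).

Lemma peval_alpha (p : nat) (q : {poly 'F_p}) : peval (alpha2 p) q = tofrac q%:P.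
Proof.
rewrite /alpha2 peval_tofrac horner_map /=.
by rewrite -/(comp_poly 'X q) comp_polyXr.
Qed.

Lemma peval_beta (p : nat) (q : {poly 'F_p}) :
  peval (beta2 p) q = tofrac (map_poly polyC q).
Proof. by rewrite /beta2 peval_tofrac -/(comp_poly _ _) comp_polyXr. Qed.

Definition alphaDbeta_poly (p : nat) (q : {poly 'F_p}) : {poly {poly 'F_p}} :=
  (map_poly polyC q) \Po ('X%:P + 'X).

Lemma peval_alphaDbeta (p : nat) (q : {poly 'F_p}) :
  peval (alpha2 p + beta2 p) q = tofrac (alphaDbeta_poly q).
Proof. by rewrite /alpha2 /beta2 -rmorphD peval_tofrac. Qed.

(** Substitutes x for beta; the values used are x = 0 and x = m alpha. *)
Lemma horner_alphaDbeta_poly (p : nat) (q x : {poly 'F_p}) :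
  (alphaDbeta_poly q).[x] = q \Po ('X + x).
Proof. by rewrite /alphaDbeta_poly horner_comp !hornerE. Qed.

Lemma specializes_fsubst_alpha (p : nat) (f : ratfun1 p) :
  spec_beta0 (fsubst (alpha2 p) f) f.
Proof.
have [d d0 [n ->]] := frac_numden f.
exists n%:P, d%:P; rewrite /= /at_beta0 !hornerC tofrac_eq0 d0; split=> //.
by rewrite fsubst_frac ?peval_alpha //; apply: peval_alpha_neq0.
Qed.

Lemma specializes_fsubst_alphaDbeta (p : nat) (f : ratfun1 p) :
  spec_beta0 (fsubst (alpha2 p + beta2 p) f) f.
Proof.
have [d d0 [n ->]] := frac_numden f.
exists (alphaDbeta_poly n), (alphaDbeta_poly d).
rewrite /= /at_beta0 !horner_alphaDbeta_poly addr0 !comp_polyXr tofrac_eq0 d0.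
split=> //.
by rewrite fsubst_frac ?peval_alphaDbeta //; apply: peval_alphaDbeta_neq0.
Qed.

Lemma horner0_map_polyC (R : comNzRingType) (q : {poly R}) :
  (map_poly polyC q).[0] = q.[0]%:P.
Proof. by rewrite -horner_map. Qed.

(** Putting beta = 0 in f(beta) evaluates f itself at 0, so f must have no pole there. *)
Lemma specializes_fsubst_beta (p : nat) (f : ratfun1 p) (e : 'F_p) :
  spec_alpha0 f e ->
  spec_beta0 (fsubst (beta2 p) f) (const1 e).
Proof.
move=> [n [d [d0 -> ->]]]; exists (map_poly polyC n), (map_poly polyC d).
have dn0 : d != 0 by apply: contraNneq d0 => ->; rewrite rmorph0.
rewrite /= /at_beta0 !horner0_map_polyC tofrac_eq0 polyC_eq0; split=> //.
  by rewrite fsubst_frac ?peval_beta //; apply: peval_beta_neq0.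
by rewrite fmorph_div.
Qed.

Lemma not_pole_specializes (p : nat) (f : ratfun1 p) :
  not_pole f 0 -> exists e, spec_alpha0 f e.
Proof.
by move=> [n [d [[_ fE _] d0]]]; exists (n.[0] / d.[0]), n, d.
Qed.

Lemma value_beta0_specializes (p : nat) (s : ratfun2 p) (f : ratfun1 p) :
  value_beta0 s f -> spec_beta0 s f.
Proof.
move=> [n [d [[_ sE _] Xd ->]]]; exists n, d; split=> //.
by rewrite /= /at_beta0 tofrac_eq0 -/(root d 0) -dvdp_XsubCl subr0.
Qed.

Lemma beta_free_denom_value (p : nat) (s : ratfun2 p) :
  beta_free_denom s -> exists f, value_beta0 s f.
Proof. by move=> [n [d [red Xd]]]; exists (tofrac n.[0] / tofrac d.[0]), n, d. Qed.

(** * Multiplicative rational functions in characteristic p *)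

Lemma comp_scaleX_neq0 (R : comNzRingType) (q : {poly R}) (c : R) :
  q.[0] != 0 -> q \Po (c *: 'X) != 0.
Proof.
apply: contraNneq => /(congr1 (horner^~ 0)).
by move=> /=; rewrite horner_comp hornerZ hornerX mulr0 horner0 => ->.
Qed.

Lemma pchar_poly_Fp (p : nat) : prime p -> p \in [pchar {poly 'F_p}].
Proof. by move=> p_pr; rewrite pchar_lalg; apply: pchar_Fp. Qed.

(* Taking beta = m alpha gives a(m alpha) = a(alpha)^m, and m = p yields a^p = 1. *)
Lemma fsubst_multiplicative_eq1 (p : nat) (a : ratfun1 p) : prime p ->
  spec_alpha0 a 1 ->
  fsubst (alpha2 p) a * fsubst (beta2 p) a = fsubst (alpha2 p + beta2 p) a ->
  a = 1.
Proof.
move=> p_pr [n [d [d0 aE nd]]].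
have dn0 : d != 0 by apply: contraNneq d0 => ->; rewrite rmorph0.
have nd0 : n.[0] = d.[0].
  by have := canRL (mulfVK d0) (esym nd); rewrite mul1r.
rewrite aE (fsubst_frac _ (@peval_alpha_neq0 p) dn0).
rewrite (fsubst_frac _ (@peval_beta_neq0 p) dn0).
rewrite (fsubst_frac _ (@peval_alphaDbeta_neq0 p) dn0) mulf_div => /eqP.
rewrite eqr_div ?mulf_neq0 ?peval_alphaDbeta_neq0 ?peval_beta_neq0 ?peval_alpha_neq0 //.
rewrite !peval_alpha !peval_beta !peval_alphaDbeta -!rmorphM tofrac_eq => /eqP E.
have comp0 (q : {poly 'F_p}) (c : 'F_p) : c = 0 -> q \Po (c *: 'X) = q.[0]%:P.
  by move->; rewrite scale0r comp_poly0r horner_coef0.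
(* The identity a(m alpha) = a(alpha)^m, cleared of denominators. *)
have Em m : (n \Po (m%:R *: 'X)) * d ^+ m = n ^+ m * (d \Po (m%:R *: 'X)).
  elim: m => [|m IHm]; first by rewrite !comp0 // nd0 mulr1 mul1r.
  have := congr1 (horner^~ (m%:R *: 'X)) E.
  rewrite /= !hornerM !hornerC !horner_alphaDbeta_poly -/(comp_poly _ n) -/(comp_poly _ d).
  have -> : 'X + m%:R *: 'X = m.+1%:R *: 'X :> {poly 'F_p}.
    by rewrite mulrS scalerDl scale1r.
  move=> {}E.
  (* The denominator d(m alpha) has constant term d(0), which is nonzero, so it cancels. *)
  apply: (mulfI (comp_scaleX_neq0 m%:R d0)); rewrite !exprS.
  move: E IHm; move: (n \Po (m%:R *: _)) (d \Po (m%:R *: _)) => N1 D1.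
  move: (n \Po _) (d \Po _) => N D E IHm.
  have -> : D1 * (N * (d * d ^+ m)) = N * (d * D1) * d ^+ m by ring.
  rewrite -E; have -> : n * N1 * D * d ^+ m = n * D * (N1 * d ^+ m) by ring.
  by rewrite IHm; ring.
(* For m = p the substituted m alpha is 0; cancelling n(0) = d(0) leaves d^p = n^p, and Frobenius
   gives d = n. *)
have := Em p; rewrite !comp0 ?pchar_Fp_0 // nd0.
rewrite [RHS]mulrC => /mulfI; rewrite polyC_eq0 => /(_ d0) dnp.
have /eqP : (d - n) ^+ p = 0.
  by rewrite -[_ ^+ p](pFrobenius_autE (pchar_poly_Fp p_pr)) rmorphB /= !pFrobenius_autE dnp subrr.
rewrite expf_eq0 prime_gt0 //= subr_eq0 => /eqP<-.
by rewrite divff ?tofrac_eq0.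
Qed.

Lemma spec_beta0_semiring (p : nat) : semiring_rel (@spec_beta0 p).
Proof. exact: specializes_semiring. Qed.

Lemma spec_alpha0_semiring (p : nat) : semiring_rel (@spec_alpha0 p).
Proof. exact: specializes_semiring. Qed.

Lemma spec_alpha0_const1 (p : nat) (c : 'F_p) : spec_alpha0 (const1 c) c.
Proof.
have := @specializes_tofrac _ _ (@at_alpha0 p) c%:P.
by rewrite /= {2}/at_alpha0 /horner_eval hornerC.
Qed.

Lemma spec_alpha0_alpha1 (p : nat) : spec_alpha0 (alpha1 p) 0.
Proof.
have := @specializes_tofrac _ _ (@at_alpha0 p) 'X.
by rewrite /= {2}/at_alpha0 /horner_eval hornerX.
Qed.

Lemma spec_beta0_tofrac (p : nat) (q : {poly {poly 'F_p}}) :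
  spec_beta0 (tofrac q) (tofrac q.[0]).
Proof. exact: (@specializes_tofrac {poly {poly 'F_p}} (ratfun1 p) (@at_beta0 p)). Qed.

Lemma spec_beta0_fun (p : nat) (f : ratfun2 p) (a b : ratfun1 p) :
  spec_beta0 f a -> spec_beta0 f b -> a = b.
Proof. exact: (@specializes_fun {poly {poly 'F_p}} (ratfun1 p) (@at_beta0 p)). Qed.

Lemma spec_alpha0_fun (p : nat) (f : ratfun1 p) (a b : 'F_p) :
  spec_alpha0 f a -> spec_alpha0 f b -> a = b.
Proof. exact: (@specializes_fun {poly 'F_p} 'F_p (@at_alpha0 p)). Qed.

Lemma spec_beta0_alpha2 (p : nat) : spec_beta0 (alpha2 p ^+ p - alpha2 p)
  (alpha1 p ^+ p - alpha1 p).
Proof.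
have := @spec_beta0_tofrac p ('X%:P ^+ p - 'X%:P).
by rewrite rmorphB rmorphXn /= !hornerE rmorphB rmorphXn.
Qed.

Lemma spec_beta0_beta2 (p : nat) : (0 < p)%N ->
  spec_beta0 (beta2 p ^+ p - beta2 p) 0.
Proof.
move=> p0; have := @spec_beta0_tofrac p ('X ^+ p - 'X).
by rewrite rmorphB rmorphXn /= !hornerE expr0n gtn_eqF // subr0 rmorph0.
Qed.

(** * The congruence at beta = 0 *)

Section BivariateRel.
Variables (R S : comNzRingType) (r : R -> S -> Prop).
Hypothesis rP : semiring_rel r.
Let rP' := poly_rel_semiring rP.
Let rP2 := poly_rel_semiring rP'.
Let rC x a : r x a -> poly_rel (poly_rel r) x%:P%:P a%:P%:P.
Proof. by move=> xa; apply: (poly_relC rP'); apply: (poly_relC rP). Qed.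

Lemma bivariate_relX : poly_rel (poly_rel r) 'X%:P 'X%:P.
Proof. by apply: (poly_relC rP'); apply: (poly_relX rP). Qed.

Lemma bivariate_relY : poly_rel (poly_rel r) 'X 'X.
Proof. exact: (poly_relX rP'). Qed.

Lemma bivariate_rel_sum n (a : nat -> R) (b : nat -> S) Z Z' :
  (forall k, (k < n)%N -> r (a k) (b k)) -> poly_rel (poly_rel r) Z Z' ->
  poly_rel (poly_rel r) (\sum_(k < n) (a k)%:P%:P * Z ^+ k)
    (\sum_(k < n) (b k)%:P%:P * Z' ^+ k).
Proof.
move=> ab ZZ'; apply: (rel_sum rP2) => k _; have [_ _ _ rM] := rP2.
by apply: rM; [apply: rC; apply: ab | apply: (rel_exp rP2)].
Qed.

Lemma bivariate_rel_cofactor n (a : nat -> R) (b : nat -> S) :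
  (forall i, (0 < i < n)%N -> r (a i) (b i)) ->
  poly_rel (poly_rel r)
    (1 + \sum_(1 <= i < n) (a i)%:P%:P * 'X%:P ^+ i * 'X ^+ (n - i))
    (1 + \sum_(1 <= i < n) (b i)%:P%:P * 'X%:P ^+ i * 'X ^+ (n - i)).
Proof.
move=> ab; have [_ r1 rD rM] := rP2; apply: rD; first exact: r1.
rewrite ![\sum_(1 <= i < n) _]big_nat; apply: (rel_sum rP2) => i i_n.
apply: (rM); last by apply: (rel_exp rP2); apply: bivariate_relY.
apply: (rM); last by apply: (rel_exp rP2); apply: bivariate_relX.
by apply: rC; apply: ab.
Qed.

End BivariateRel.

(** As a composite, P(X + Y) can be evaluated at Y = 0 and differentiated in Y. *)
Lemma sum_coef_expr (R : comNzRingType) (q : {poly R}) (Z : {poly {poly R}}) :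
  \sum_(k < size q) (q`_k)%:P%:P * Z ^+ k = map_poly polyC q \Po Z.
Proof.
rewrite comp_polyE size_map_polyC; apply: eq_bigr => k _.
by rewrite coef_map mul_polyC.
Qed.

Lemma comp_shift_coef0 (R : comNzRingType) (q : {poly R}) :
  (map_poly polyC q \Po ('X%:P + 'X))`_0 = q.
Proof.
by rewrite -horner_coef0 horner_comp !hornerE -/(comp_poly _ _) comp_polyXr.
Qed.

(** The coefficient of Y is the Y-derivative at Y = 0, computed by the chain rule. *)
Lemma comp_shift_coef1 (R : comNzRingType) (q : {poly R}) :
  (map_poly polyC q \Po ('X%:P + 'X))`_1 = q^`().
Proof.
rewrite -[LHS]mulr1n -coef_deriv deriv_comp derivD derivC derivX add0r mulr1.
by rewrite deriv_map comp_shift_coef0.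
Qed.

(** The normal-form coefficients of both sides of the congruence agree; they specialize to the two
    sides of the conclusion, and specialized values are unique. *)
Lemma congr_beta0 (p : nat) (P : {poly ratfun1 p}) (s : nat -> ratfun2 p)
    (e : nat -> 'F_p) (t : nat -> ratfun1 p) (u v : nat) : (0 < p)%N -> (v < p)%N ->
  congr_ideal2
    (varX p ^+ p - cXY (alpha2 p ^+ p - alpha2 p))
    (varY p ^+ p - cXY (beta2 p ^+ p - beta2 p))
    (subst_poly P (alpha2 p) (varX p) * subst_poly P (beta2 p) (varY p))
    (subst_poly P (alpha2 p + beta2 p) (varX p + varY p) *
       (1 + \sum_(1 <= i < p) cXY (s i) * varX p ^+ i * varY p ^+ (p - i))) ->
  (forall k, (k < size P)%N -> spec_alpha0 P`_k (e k)) ->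
  (forall i, (0 < i < p)%N -> spec_beta0 (s i) (t i)) ->
  wsum (reduction_weight p (alpha1 p ^+ p - alpha1 p) u)
    (P%:P * (\sum_(k < size P) (const1 (e k))%:P%:P * 'X ^+ k))`_v =
  wsum (reduction_weight p (alpha1 p ^+ p - alpha1 p) u)
    ((map_poly polyC P \Po ('X%:P + 'X)) *
     (1 + \sum_(1 <= i < p) (t i)%:P%:P * 'X%:P ^+ i * 'X ^+ (p - i)))`_v.
Proof.
move=> p0 vp PP eP tP; have rP := spec_beta0_semiring p.
have rP2 := poly_rel_semiring (poly_rel_semiring rP); have [_ _ rD rM] := rP2.
have rA := spec_beta0_alpha2 p; have rB := spec_beta0_beta2 p0.
have nE := normal_coef_congr u v p0 PP.
have rX := bivariate_relX rP; have rY := bivariate_relY rP.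
have rXY := rD _ _ _ _ rX rY.
have rPa := bivariate_rel_sum rP
  (fun k (_ : (k < size P)%N) => specializes_fsubst_alpha P`_k) rX.
have rPb := bivariate_rel_sum rP
  (fun k kP => specializes_fsubst_beta (eP k kP)) rY.
have rPab := bivariate_rel_sum rP
  (fun k (_ : (k < size P)%N) => specializes_fsubst_alphaDbeta P`_k) rXY.
have rs := bivariate_rel_cofactor rP tP.
have PE : P%:P = \sum_(k < size P) (P`_k)%:P%:P * 'X%:P ^+ k.
  by rewrite sum_coef_expr comp_polyCr -/(comp_poly _ _) comp_polyXr.
have rl := normal_coef_rel u rP rA rB p0 vp (rM _ _ _ _ rPa rPb).
have rr := normal_coef_rel u rP rA rB p0 vp (rM _ _ _ _ rPab rs).
rewrite -PE in rl; rewrite sum_coef_expr in rr.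
apply: (spec_beta0_fun rl).
exact: (eq_ind_r (fun x => spec_beta0 x _) rr nE).
Qed.

(** * The constant coefficient of the congruence for general beta *)

Section ConstantCoef.
Variables (R : comNzRingType) (n : nat) (A B : R).

(** Each factor has degree less than n in its own variable, so the product is already reduced. *)
Lemma normal_coef00_prod m (a b : nat -> R) : (m < n)%N ->
  normal_coef n A B 0 0 ((\sum_(k < m.+1) (a k)%:P%:P * 'X%:P ^+ k) *
                         (\sum_(k < m.+1) (b k)%:P%:P * 'X ^+ k)) = a 0%N * b 0%N.
Proof.
move=> mn; have kn (k : 'I_m.+1) : (k < n)%N by apply: leq_trans mn.
rewrite mulr_suml raddf_sum /=; under eq_bigr => k _.
  rewrite mulr_sumr raddf_sum /=; under eq_bigr => l _.
    have -> : forall x y z t : {poly {poly R}}, x * y * (z * t) = x * z * y * t.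
      by move=> *; ring.
    rewrite -!polyCM normal_coef_monomial !reduction_weight_small //; over.
  rewrite big_ord_recl big1 ?addr0 ?mulr1 => [|l _]; last by rewrite mulr0.
  over.
rewrite big_ord_recl big1 ?addr0 => [|k _]; last by rewrite mulr0.
by rewrite mulr1.
Qed.

Lemma normal_coef00_cofactor m (a s : nat -> R) : (m < n)%N ->
  normal_coef n A B 0 0 ((\sum_(k < m.+1) (a k)%:P%:P * ('X%:P + 'X) ^+ k) *
    (1 + \sum_(1 <= i < n) (s i)%:P%:P * 'X%:P ^+ i * 'X ^+ (n - i))) = a 0%N.
Proof.
move=> mn; have kn (k : 'I_m.+1) : (k < n)%N by apply: leq_trans mn.
rewrite mulrDr mulr1 mulr_sumr raddfD /= !raddf_sum /=.
rewrite [X in _ + X]big_nat [X in _ + X]big1 ?addr0; last first.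
  move=> i i_n; rewrite mulr_suml raddf_sum big1 //= => k _.
  have -> : forall x y z t u : {poly {poly R}},
    x * y * (z * t * u) = z * x * y * (t * u) by move=> *; ring.
  by rewrite -!polyCM; apply: normal_coef00_exprD_mixed.
under eq_bigr do rewrite normal_coef00_exprD //.
by rewrite big_ord_recl big1 ?addr0.
Qed.

End ConstantCoef.

(** Supplies the functional equation used by [fsubst_multiplicative_eq1]. *)
Lemma subst_poly_coef0 (p : nat) (P : {poly ratfun1 p}) (s : nat -> ratfun2 p) :
  (0 < p)%N -> (size P <= p)%N -> P != 0 ->
  congr_ideal2
    (varX p ^+ p - cXY (alpha2 p ^+ p - alpha2 p))
    (varY p ^+ p - cXY (beta2 p ^+ p - beta2 p))
    (subst_poly P (alpha2 p) (varX p) * subst_poly P (beta2 p) (varY p))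
    (subst_poly P (alpha2 p + beta2 p) (varX p + varY p) *
       (1 + \sum_(1 <= i < p) cXY (s i) * varX p ^+ i * varY p ^+ (p - i))) ->
  fsubst (alpha2 p) P`_0 * fsubst (beta2 p) P`_0 =
  fsubst (alpha2 p + beta2 p) P`_0.
Proof.
move=> p0 Pp P0 PP; have nE := normal_coef_congr 0 0 p0 PP.
(* As P is nonzero its size is m + 1, so the sums contain the index 0. *)
case sP : (size P) => [|m]; first by move/eqP: sP; rewrite size_poly_eq0 (negPf P0).
have mp : (m < p)%N by rewrite -sP.
have l := normal_coef00_prod _ _ (fun k => fsubst (alpha2 p) P`_k)
  (fun k => fsubst (beta2 p) P`_k) mp.
have r := normal_coef00_cofactor _ _ (fun k => fsubst (alpha2 p + beta2 p) P`_k) s mp.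
move: nE; rewrite /subst_poly sP => nE.
exact: etrans (esym (l _ _)) (etrans nE (r _ _)).
Qed.

(** * The coefficients of Y^0 and Y^1 at beta = 0 *)

Section CofactorCoef.
Variables (R : comNzRingType) (n : nat) (a : nat -> R).

Let cofactor : {poly {poly R}} :=
  1 + \sum_(1 <= i < n) (a i)%:P%:P * 'X%:P ^+ i * 'X ^+ (n - i).

Let coef_cofactor v : cofactor`_v =
  (v == 0%N)%:R + \sum_(1 <= i < n) (a i)%:P * 'X^i *+ (v == n - i)%N.
Proof.
rewrite coefD coef1 coef_sum; congr (_ + _); apply: eq_bigr => i _.
by rewrite -polyC_exp -polyCM coefCM coefXn mulr_natr.
Qed.

Lemma cofactor_coef0 : cofactor`_0 = 1.
Proof.
rewrite coef_cofactor big_nat big1 ?addr0 // => i /andP[_ i_n].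
by rewrite eq_sym subn_eq0 leqNgt i_n.
Qed.

(** Y^(n-i) is Y only for i = n - 1; hence only s_(p-1) enters the recurrence. *)
Lemma cofactor_coef1 : (1 < n)%N -> cofactor`_1 = (a n.-1)%:P * 'X^(n.-1).
Proof.
rewrite coef_cofactor add0r; case: n => [|[|m]] //= _.
rewrite big_nat_recr //= subSnn eqxx big_nat big1 ?add0r // => i /andP[_ im].
by case: eqP => // E; exfalso; lia.
Qed.

End CofactorCoef.

Lemma reduction_shift_coef (R : comNzRingType) n (A : R) u (q : {poly R}) :
  (0 < n)%N -> (size q <= n)%N -> (u < n)%N ->
  wsum (reduction_weight n A u) ('X^(n.-1) * q) = q`_0 *+ (u == n.-1) + A * q`_u.+1.
Proof. by case: n => // m _; apply: wsum_reduction_coef_Xn. Qed.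

Section SpecializedCoef.
Variables (R : comNzRingType) (n : nat) (A : R) (u : nat) (q : {poly R}).
Hypothesis qn : (size q <= n)%N.

(** The conditional covers a constant P, where there is no term in Y^1. *)
Lemma wsum_specialized_prod (b : nat -> R) m v :
  wsum (reduction_weight n A u) (q%:P * (\sum_(k < m) (b k)%:P%:P * 'X ^+ k))`_v =
  (if (v < m)%N then b v else 0) * q`_u.
Proof.
under eq_bigr do rewrite mul_polyC.
rewrite -(poly_def m (fun k => (b k)%:P)) coefCM coef_poly mulrC.
by rewrite -(fun_if polyC) wsumC wsum_reduction_coef.
Qed.

Lemma wsum_specialized_cofactor0 (a : nat -> R) :
  wsum (reduction_weight n A u) ((map_poly polyC q \Po ('X%:P + 'X)) *
    (1 + \sum_(1 <= i < n) (a i)%:P%:P * 'X%:P ^+ i * 'X ^+ (n - i)))`_0 = q`_u.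
Proof.
rewrite coefM big_ord1 subnn comp_shift_coef0 cofactor_coef0 mulr1.
exact: wsum_reduction_coef.
Qed.

(** Before reduction, the coefficient of Y is q' + a_(n-1) X^(n-1) q. *)
Lemma wsum_specialized_cofactor1 (a : nat -> R) : (1 < n)%N -> (u < n)%N ->
  wsum (reduction_weight n A u) ((map_poly polyC q \Po ('X%:P + 'X)) *
    (1 + \sum_(1 <= i < n) (a i)%:P%:P * 'X%:P ^+ i * 'X ^+ (n - i)))`_1 =
  q`_u.+1 *+ u.+1 + a n.-1 * (q`_0 *+ (u == n.-1) + A * q`_u.+1).
Proof.
move=> n1 un; have n0 := ltnW n1.
rewrite coefM big_ord_recl big_ord1 /= subn0.
rewrite comp_shift_coef0 comp_shift_coef1 cofactor_coef0 cofactor_coef1 // mulr1.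
rewrite addrC linearD /= [q * _]mulrC -[_ * 'X^_ * q]mulrA wsumC.
rewrite reduction_shift_coef // wsum_reduction_coef ?coef_deriv //.
by rewrite (leq_trans (size_poly _ _)) // (leq_trans (leq_pred _)).
Qed.

End SpecializedCoef.

Lemma congr_beta0_recurrence (p : nat) (P : {poly ratfun1 p}) (s : nat -> ratfun2 p)
    (f : ratfun1 p) : prime p -> (size P <= p)%N -> P != 0 ->
  congr_ideal2
    (varX p ^+ p - cXY (alpha2 p ^+ p - alpha2 p))
    (varY p ^+ p - cXY (beta2 p ^+ p - beta2 p))
    (subst_poly P (alpha2 p) (varX p) * subst_poly P (beta2 p) (varY p))
    (subst_poly P (alpha2 p + beta2 p) (varX p + varY p) *
       (1 + \sum_(1 <= i < p) cXY (s i) * varX p ^+ i * varY p ^+ (p - i))) ->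
  (forall i, (0 < i < p)%N -> beta_free_denom (s i)) ->
  value_beta0 (s p.-1) f ->
  (forall k : nat, not_pole P`_k 0) ->
  spec_alpha0 P`_0 1 /\
  exists c : 'F_p, forall u, (u < p)%N ->
    const1 c * P`_u = P`_u.+1 *+ u.+1 +
      f * (P`_0 *+ (u == p.-1) + (alpha1 p ^+ p - alpha1 p) * P`_u.+1).
Proof.
move=> p_pr Pp P0 PP s_den sf P_pole; have p1 := prime_gt1 p_pr.
have p0 := ltnW p1; have P_gt0 : (0 < size P)%N by rewrite size_poly_gt0.
have [|e eP] := @nat_bounded_choice _ 0 (fun k => spec_alpha0 P`_k) (size P).
  by move=> k _; apply: not_pole_specializes.
have [|t tP] := @nat_bounded_choice _ 0
    (fun i x => (0 < i)%N -> spec_beta0 (s i) x) p.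
  (* Index 0 is outside the range of the s_i and gets a dummy value. *)
  move=> [|i] ip; first by exists 0.
  have [|g /value_beta0_specializes sg] := beta_free_denom_value (s_den i.+1 _).
    by [].
  by exists g.
have {}tP i : (0 < i < p)%N -> spec_beta0 (s i) (t i).
  by case/andP=> i0 ip; apply: tP.
have tf : t p.-1 = f.
  apply: spec_beta0_fun (tP _ _) (value_beta0_specializes sf).
  by rewrite -ltnS prednK // p1 leqnn.
have E0 u := congr_beta0 u p0 p0 PP eP tP.
have E1 u := congr_beta0 u p0 p1 PP eP tP.
split.
  suff <- : e 0%N = 1 by apply: eP.
  (* The coefficient of Y^0 says a_0(0) P = P; comparing leading coefficients gives a_0(0) = 1. *)
  have l := wsum_specialized_prod (alpha1 p ^+ p - alpha1 p) (size P).-1 Pp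
    (fun k => const1 (e k)) (size P) 0.
  have := etrans (esym l) (etrans (E0 _) (wsum_specialized_cofactor0 _ _ Pp _)).
  rewrite P_gt0 -lead_coefE -[RHS]mul1r => /mulIf.
  rewrite lead_coef_eq0 => /(_ P0).
  by rewrite -(rmorph1 (@const1 p)) => /fmorph_inj.
(* The witness is a_1(0), read as 0 when P is constant. *)
exists (if (1 < size P)%N then e 1%N else 0) => u up.
have l := wsum_specialized_prod (alpha1 p ^+ p - alpha1 p) u Pp
  (fun k => const1 (e k)) (size P) 1.
have r := wsum_specialized_cofactor1 (alpha1 p ^+ p - alpha1 p) Pp t p1 up.
rewrite tf in r; have := etrans (esym l) (etrans (E1 u) r).
by case: ifP => // _; rewrite rmorph0.
Qed.

(** * The Artin-Schreier equation and the conclusion *)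

Lemma spec_alpha0_ArtinSchreier (p : nat) : (0 < p)%N ->
  spec_alpha0 (alpha1 p ^+ p - alpha1 p) 0.
Proof.
move=> p0; have := @specializes_tofrac _ _ (@at_alpha0 p) ('X ^+ p - 'X).
by rewrite rmorphB rmorphXn /= {2}/at_alpha0 /horner_eval !hornerE expr0n gtn_eqF // subr0.
Qed.

(** At alpha = 0 the sum k + g takes the value k, nonzero in F_p. *)
Lemma natr_spec0_neq0 (p : nat) (g : ratfun1 p) k : prime p ->
  spec_alpha0 g 0 -> (0 < k < p)%N -> k%:R + g != 0.
Proof.
move=> p_pr g0 /andP[k0 kp]; have [r0 _ rD _] := spec_alpha0_semiring p.
have := rD _ _ _ _ (spec_alpha0_const1 (k%:R : 'F_p)) g0.
rewrite rmorph_nat addr0 => rk; apply/eqP => kg.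
rewrite kg in rk; have /eqP := spec_alpha0_fun rk r0.
by rewrite -(dvdn_pcharf (pchar_Fp p_pr)) gtnNdvd.
Qed.

(* Two solutions of z^p - z = c (alpha^p - alpha) differ by an element of F_p. *)
Lemma ArtinSchreier_unique (p : nat) (g : ratfun1 p) (c : 'F_p) : prime p ->
  spec_alpha0 g 0 -> g ^+ p - g = const1 c * (alpha1 p ^+ p - alpha1 p) ->
  g = const1 c * alpha1 p.
Proof.
move=> p_pr g0 gE; have [r0 _ rD rM] := spec_alpha0_semiring p.
have p_char : p \in [pchar ratfun1 p] by apply: rmorph_pchar (@const1 p) _ _; apply: pchar_Fp.
have cp : const1 (- c) ^+ p = const1 (- c).
  by rewrite -rmorphXn /= -{2}(expf_card (- c)) card_Fp.
pose z := g + const1 (- c) * alpha1 p.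
have [] := @Frobenius_fixed p _ (@const1 p) z p_pr.
  rewrite -[LHS](pFrobenius_autE p_char) rmorphD rmorphM /= !pFrobenius_autE.
  apply/eqP; rewrite cp -subr_eq0 /z rmorphN /=; apply/eqP.
  have -> : g ^+ p + - const1 c * alpha1 p ^+ p - (g + - const1 c * alpha1 p) =
     (g ^+ p - g) - const1 c * (alpha1 p ^+ p - alpha1 p) by ring.
  by rewrite gE subrr.
(* z is a constant whose value at alpha = 0 is 0, hence z = 0. *)
move=> d zd; have rz : spec_alpha0 z 0.
  have := rD _ _ _ _ g0 (rM _ _ _ _ (spec_alpha0_const1 (- c)) (spec_alpha0_alpha1 p)).
  by rewrite mulr0 addr0.
have d0 : d = 0 by rewrite zd in rz; apply: spec_alpha0_fun (spec_alpha0_const1 d) rz.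
move: zd; rewrite d0 rmorph0 /z rmorphN /= mulNr => /eqP.
by rewrite subr_eq0 => /eqP.
Qed.

Theorem theorem3 (p : nat) (p_prime : prime p)
    (P : {poly ratfun1 p}) (P_neq0 : P != 0) (P_deg : (size P <= p)%N)
    (s : nat -> ratfun2 p)
    (P_mul : congr_ideal2
       (varX p ^+ p - cXY (alpha2 p ^+ p - alpha2 p))
       (varY p ^+ p - cXY (beta2 p ^+ p - beta2 p))
       (subst_poly P (alpha2 p) (varX p) * subst_poly P (beta2 p) (varY p))
       (subst_poly P (alpha2 p + beta2 p) (varX p + varY p) *
          (1 + \sum_(1 <= i < p) cXY (s i) * varX p ^+ i * varY p ^+ (p - i))))
    (s_den : forall i : nat, (1 <= i < p)%N -> beta_free_denom (s i))
    (s_pole : exists2 f : ratfun1 p,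
       value_beta0 (s p.-1) f & not_pole f 0)
    (P_pole : forall k : nat, not_pole P`_k 0) :
  exists c : 'F_p,
    P = calE p (const1 c * alpha1 p) \Po (const1 c *: 'X).
Proof.
have p0 := prime_gt0 p_prime; have [f sf f_pole] := s_pole.
have [P01 [c rec]] :=
  congr_beta0_recurrence p_prime P_deg P_neq0 P_mul s_den sf P_pole.
have P0 := fsubst_multiplicative_eq1 p_prime P01
  (subst_poly_coef0 p0 P_deg P_neq0 P_mul).
have [a fa] := not_pole_specializes f_pole; have [_ _ _ rM] := spec_alpha0_semiring p.
move: rec (spec_alpha0_ArtinSchreier p0) (@ArtinSchreier_unique p).
move: (_ ^+ p - alpha1 p) => A rec A0 AS.
have t0 : spec_alpha0 (f * A) 0 by have := rM _ _ _ _ fa A0; rewrite mulr0.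
have kt k kp := natr_spec0_neq0 p_prime t0 (k := k) kp.
(* The recurrence gives the required shape with t = f A; it remains to identify t with c alpha. *)
have PE : P = calE p (f * A) \Po (const1 c *: 'X).
  rewrite -[RHS]scale1r -P0; apply: calE_of_recurrence => // k kp.
  rewrite rec ?(ltnW kp) // (_ : k == p.-1 = false) ?add0r; last by lia.
  by rewrite mulrDl mulrA mulr_natl.
exists c; rewrite {1}PE; congr (calE p _ \Po _).
apply: AS => //.
have cp : const1 c ^+ p = const1 c by rewrite -rmorphXn -{2}(expf_card c) card_Fp.
(* The equation t^p - t = c A is proved by factoring its left side. *)
rewrite -(prod_shift_Fp (@const1 p)) //.
(* The coefficient of index p vanishes by the degree bound, which leaves c a_(p-1) = f. *)
have := rec p.-1; rewrite prednK // leqnn => /(_ isT).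
rewrite eqxx [P`_p]nth_default // mul0rn mulr0 addr0 add0r P0 mulr1 => fE.
rewrite big_ltn // add0r.
have : (\prod_(1 <= j < p) (j%:R + f * A)) != 0.
  by rewrite prodf_seq_neq0; apply/allP => j; rewrite mem_index_iota => /kt.
(* Here a_(p-1) is c^(p-1) divided by the product of the j + t for 0 < j < p, so f times that
   product is c^p = c; the factor j = 0 is f A. *)
have := congr1 (coefp p.-1) PE; rewrite /= coef_comp_scaleX coef_poly.
rewrite prednK // leqnn => Pp.
move: fE; rewrite Pp; move: (\prod_(_ <= _ < _) _) => x fE x0.
have {}cp : const1 c * const1 c ^+ p.-1 = const1 c by rewrite -exprS prednK.
rewrite -[in RHS]cp -{1}fE mulrAC; congr (_ * _).
by rewrite -mulrA; congr (_ * _); rewrite mulrAC mulVf // mul1r.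
Qed.
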